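(* Let $q$ be a prime power with $q\equiv 2\pmod 3$. Let $\mathcal{M}=\bigcup_{z\in E}O_{(1,z)}$, a set of points of the hyperbolic quadric $\mathcal{Q}^+(5,q)$ defined by the quadratic form $Q((x,y))=\mathrm{Tr}_{q^3/q}(xy)$ on $V=\mathbb{F}_{q^3}\times\mathbb{F}_{q^3}$, where $E$ and $O_{(1,z)}$ are as defined in the context. Then the set $\mathcal{L}$ of lines of $\mathrm{PG}(3,q)$ corresponding to $\mathcal{M}$ under the Klein correspondence is a Cameron-Liebler line class with parameter $x=(q+1)^2/3$.
   Context: Let $\mathrm{Tr}_{q^3/q}$ and $\mathrm{N}_{q^3/q}$ be the relative trace and norm from $\mathbb{F}_{q^3}$ to $\mathbb{F}_q$. Cameron-Liebler line classes: a spread of $\mathrm{PG}(3,q)$ is a set of lines partitioning the points. A set $\mathcal{L}$ of lines of $\mathrm{PG}(3,q)$ with $|\mathcal{L}|=x(q^2+q+1)$, $x$ a positive integer, is a Cameron-Liebler line class with parameter $x$ if $|\mathcal{L}\cap\mathcal{S}|=x$ for every spread $\mathcal{S}$ of $\mathrm{PG}(3,q)$. The set $E$: put $T_0=\{x\in\mathbb{F}_{q^3}^*:\mathrm{Tr}_{q^3/q}(x)=0\}$ and $L_0=\{x\in T_0:\mathrm{N}_{q^3/q}(x)=1\}$. Since $q\equiv2\pmod 3$, $y\mapsto y^3$ is a permutation of $\mathbb{F}_q$; its inverse is written $y\mapsto y^{1/3}$, and $y^{-1/3}=(y^{1/3})^{-1}$ for $y\ne0$. Let $\beta=-3^{-1}\in\mathbb{F}_q$.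 Define multisets $D_1=[x\,\mathrm{N}_{q^3/q}(\lambda+x^q-x^{q^2})^{1/3}: x\in L_0,\lambda\in\mathbb{F}_q]$ and $D_2=[\beta^{-1}x\,\mathrm{N}_{q^3/q}(\lambda+x^q-x^{q^2})^{-1/3}: x\in L_0,\lambda\in\mathbb{F}_q]$. Then $E$ is the (unique) subset of $\mathbb{F}_{q^3}^*$ such that $D_1+D_2=3E+T_0$ in the group ring $\mathbb{Z}[\mathbb{F}_{q^3}^*]$, where (multi)sets are identified with the formal sums of their elements with multiplicity; such a subset exists, is contained in $T_0$, and has size $(q+1)^2/3$. The quadric: $V=\mathbb{F}_{q^3}\times\mathbb{F}_{q^3}$ is regarded as a 6-dimensional $\mathbb{F}_q$-space; $Q:V\to\mathbb{F}_q$, $Q((x,y))=\mathrm{Tr}_{q^3/q}(xy)$, is a non-degenerate hyperbolic quadratic form, and its singular points $\langle(x,y)\rangle$ form the model of $\mathcal{Q}^+(5,q)$ (the Klein quadric) that is used. The Klein correspondence is the standard bijection between lines of $\mathrm{PG}(3,q)$ and points of $\mathcal{Q}^+(5,q)$. Let $C_0$ be the subgroup of $\mathbb{F}_{q^3}^*$ of order $q^2+q+1$; $\mu\in C_0$ acts on points of $\mathcal{Q}^+(5,q)$ by $\langle(x,y)\rangle\mapsto\langle(\mu x,\mu^{-1}y)\rangle$, and $O_{(a,b)}$ denotes the orbit of $\langle(a,b)\rangle$ under this action of $C_0$. *)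

(* Defs.v *)
From HB Require Import structures.
From mathcomp Require Import all_boot all_order all_fingroup all_algebra all_solvable all_field.

Set Implicit Arguments.
Unset Strict Implicit.
Unset Printing Implicit Defensive.

Import GRing.Theory.
Local Open Scope ring_scope.

(* {vspace vT} has no countType or finType instance in the library. *)
HB.instance Definition _ (F : finFieldType) (vT : vectType F) :=
  isCountable.Build {vspace vT}
    (pcan_pickleK (can_pcan (@VectorInternalTheory.vs2mxK F vT))).
HB.instance Definition _ (F : finFieldType) (vT : vectType F) :=
  isFinite.Build {vspace vT}
    (pcan_enumP (can_pcan (@VectorInternalTheory.vs2mxK F vT))).

Section ProjectiveSpace.
Variable F : finFieldType.

Definition pg_points : {set {vspace 'rV[F]_4}} := [set P | \dim P == 1%N].
Definition pg_lines : {set {vspace 'rV[F]_4}} := [set l | \dim l == 2%N].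

Definition points_on (l : {vspace 'rV[F]_4}) : {set {vspace 'rV[F]_4}} :=
  [set P in pg_points | (P <= l)%VS].

Definition is_spread (S : {set {vspace 'rV[F]_4}}) : bool :=
  (S \subset pg_lines) && partition (points_on @: S) pg_points.

Definition cameron_liebler (A : {set {vspace 'rV[F]_4}}) (x : nat) : Prop :=
  [/\ A \subset pg_lines,
      (0 < x)%N,
      #|A| = (x * (#|F| ^ 2 + #|F| + 1))%N
    & forall S : {set {vspace 'rV[F]_4}}, is_spread S -> #|A :&: S| = x].

(* Pluecker coordinates (p01, p02, p03, p12, p13, p23). *)
Definition plucker (u v : 'rV[F]_4) : 'rV[F]_6 :=
  let p (i j : nat) := u 0 (inord i) * v 0 (inord j)
                       - u 0 (inord j) * v 0 (inord i) in
  \row_(k < 6) [:: p 0 1; p 0 2; p 0 3; p 1 2; p 1 3; p 2 3]`_k.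

Definition klein_form (w : 'rV[F]_6) : F :=
  w 0 (inord 0) * w 0 (inord 5) - w 0 (inord 1) * w 0 (inord 4)
  + w 0 (inord 2) * w 0 (inord 3).

(* Another basis of l rescales the Pluecker vector by a determinant, so the
   point does not depend on the choice of vbasis. *)
Definition klein_point (l : {vspace 'rV[F]_4}) : {vspace 'rV[F]_6} :=
  <[plucker (vbasis l)`_0 (vbasis l)`_1]>%VS.

End ProjectiveSpace.

Section CubicExtension.
Variables (F : finFieldType) (L : fieldExtType F).
Local Notation K := (finvect_type L).
Local Notation q := #|F|.

(* The preimage under the embedding a |-> a%:A of F in K (0 off its image). *)
Definition to_base (x : K) : F := odflt 0 [pick a : F | a%:A == x].

Definition trK (x : K) : F := to_base (galTrace 1 fullv x).
Definition normK (x : K) : F := to_base (galNorm 1 fullv x).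

Definition T0 : {set K} := [set x | (x != 0) && (trK x == 0)].
Definition L0 : {set K} := [set x in T0 | normK x == 1].

(* finv is the inverse function as soon as y |-> y ^+ 3 is injective on F. *)
Definition cbrt : F -> F := finv (fun y : F => y ^+ 3).

Definition beta : F := - 3%:R^-1.

Definition normD (x : K) (lam : F) : F :=
  normK (lam%:A + x ^+ q - x ^+ (q ^ 2)).

Definition D1 : seq K :=
  [seq cbrt (normD x lam) *: x | x <- enum L0, lam <- enum F].
Definition D2 : seq K :=
  [seq (beta^-1 * (cbrt (normD x lam))^-1) *: x | x <- enum L0, lam <- enum F].

(* D1 + D2 = 3 E + T0 in Z[K^*], compared coefficient by coefficient. *)
Definition is_E (E : {set K}) : Prop :=
  0 \notin E /\
  forall z : K, z != 0 ->
    (count_mem z D1 + count_mem z D2 = 3 * (z \in E) + (z \in T0))%N.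

Local Notation V := (K * K)%type.

Definition Q (v : V) : F := trK (v.1 * v.2).

Definition orbitO (C0 : {group {unit K}}) (a b : K) : {set {vspace V}} :=
  [set <[((val mu * a, (val mu)^-1 * b)%R : V)]>%VS | mu in C0].

Definition setM (C0 : {group {unit K}}) (E : {set K}) : {set {vspace V}} :=
  \bigcup_(z in E) orbitO C0 1 z.

(* Identification of the Klein quadric with the quadric Q = 0, i.e. a
   linear isomorphism that is a similarity of the two quadratic forms. *)
Definition klein_identification (phi : 'Hom('rV[F]_6, V)) : Prop :=
  bijective phi /\
  exists2 c : F, c != 0 & forall w, Q (phi w) = c * klein_form w.

Definition lines_of (phi : 'Hom('rV[F]_6, V)) (M : {set {vspace V}}) :
    {set {vspace 'rV[F]_4}} :=
  [set l in pg_lines F | (phi @: klein_point l)%VS \in M].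

End CubicExtension.

(* Main.v *)
(** A set of lines of PG(3,q) is a Cameron-Liebler line class as soon as every
    line l meets exactly x(q+1) + q^2 [l in L] of its members (count pairs of
    intersecting lines from L and from a spread).  On the Klein quadric this asks
    for #{(m, z) : m in C0, z in E, Tr(m^-1 z + m b) = 0} to be
    |E|(q+1) + q^2 [b in E] for b in T0.  By D1 + D2 = 3E + T0 one may sum over
    D1, D2 and T0 instead of E.  After normalization by cube roots of norms,
    D2 = {d(w) : w in C0 \ 1} where d(w) = w^q - w^(q^2), and for m of norm 1
    one has Tr(m^-1 d(w/m)) = - Tr(m d(w)); so substituting w/m for w turns the
    equation into the linear one Tr(m (b - d(w))) = 0 in m, which has q+1
    solutions in C0, or q^2+q+1 if d(w) = b.  T0 is handled in the same way with
    w ranging over the whole field, and D1 is the image of D2 under an involution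
    c x |-> beta^-1 c^-1 x (c in F_q^*, N(x) = 1) that preserves the count. *)

Require Import Defs.
From HB Require Import structures.
From mathcomp Require Import all_boot all_order all_fingroup all_algebra all_solvable all_field.
From mathcomp Require Import ring zify.

Set Implicit Arguments.
Unset Strict Implicit.
Unset Printing Implicit Defensive.

Import GRing.Theory.
Local Open Scope ring_scope.

(** * The Klein correspondence *)

Section KleinCorrespondence.
Variable F : finFieldType.
Implicit Types (u v a b : 'rV[F]_4) (w : 'rV[F]_6) (l : {vspace 'rV[F]_4}).

Definition klein_pol w w' : F :=
  klein_form (w + w') - klein_form w - klein_form w'.

(* The rows of this matrix span the line with Pluecker vector w. *)
Definition skew w : 'M[F]_4 :=
  let p k := w 0 (inord k) in
  \matrix_(i, j) (nth [::] [:: [:: 0; p 0; p 1; p 2];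
                               [:: - p 0; 0; p 3; p 4];
                               [:: - p 1; - p 3; 0; p 5];
                               [:: - p 2; - p 4; - p 5; 0]] i)`_j.

Lemma pluckerE u v k : (k < 6)%N ->
  plucker u v 0 (inord k) =
  [:: u 0 (inord 0) * v 0 (inord 1) - u 0 (inord 1) * v 0 (inord 0);
      u 0 (inord 0) * v 0 (inord 2) - u 0 (inord 2) * v 0 (inord 0);
      u 0 (inord 0) * v 0 (inord 3) - u 0 (inord 3) * v 0 (inord 0);
      u 0 (inord 1) * v 0 (inord 2) - u 0 (inord 2) * v 0 (inord 1);
      u 0 (inord 1) * v 0 (inord 3) - u 0 (inord 3) * v 0 (inord 1);
      u 0 (inord 2) * v 0 (inord 3) - u 0 (inord 3) * v 0 (inord 2)]`_k.
Proof. by move=> ltk; rewrite mxE inordK. Qed.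

Lemma row_ext n (x y : 'rV[F]_n.+1) :
  (forall k, (k < n.+1)%N -> x 0 (inord k) = y 0 (inord k)) -> x = y.
Proof. by move=> xy; apply/rowP=> k; have := xy k (ltn_ord k); rewrite inord_val. Qed.

Lemma plucker_singular u v : klein_form (plucker u v) = 0.
Proof. by rewrite /klein_form !pluckerE //=; ring. Qed.

Lemma plucker_comb u v (c d c' d' : F) :
  plucker (c *: u + d *: v) (c' *: u + d' *: v) = (c * d' - d * c') *: plucker u v.
Proof.
apply: row_ext => k ltk; rewrite [RHS]mxE !pluckerE // !mxE.
by case: k ltk => [|[|[|[|[|[|]]]]]] //= _; ring.
Qed.

Lemma skew_row w i j : (i < 4)%N -> (j < 4)%N ->
  row (inord i) (skew w) 0 (inord j) =
  let p k := w 0 (inord k) in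
  (nth [::] [:: [:: 0; p 0; p 1; p 2];
                [:: - p 0; 0; p 3; p 4];
                [:: - p 1; - p 3; 0; p 5];
                [:: - p 2; - p 4; - p 5; 0]] i)`_j.
Proof. by move=> lti ltj; rewrite !mxE !inordK. Qed.

(** Here [skew] is the matrix u^T v - v^T u, whose rows lie on the line; this is how a line is
    recovered from its Klein point. *)
Lemma skew_plucker u v i : (i < 4)%N ->
  row (inord i) (skew (plucker u v)) = u 0 (inord i) *: v - v 0 (inord i) *: u.
Proof.
move=> lti; apply: row_ext => j ltj; rewrite skew_row //= !pluckerE //= !mxE.
by case: i lti => [|[|[|[|]]]] //= _; case: j ltj => [|[|[|[|]]]] //= _; ring.
Qed.

(** [klein_form] is the Pfaffian of [skew w]. When it vanishes, rows i and j have Pluecker vector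
    p_ij times [w], so a nonzero coordinate of [w] selects two suitable rows. *)
Lemma plucker_skew w : w != 0 -> klein_form w = 0 ->
  exists i, exists2 j, (i < 4)%N && (j < 4)%N &
  exists2 c, c != 0 & plucker (row (inord i) (skew w)) (row (inord j) (skew w)) = c *: w.
Proof.
move=> wN0 sing.
have [|] := boolP [exists k : 'I_6, w 0 k != 0]; last first.
  rewrite negb_exists => /forallP w0; case/eqP: wN0; apply/rowP=> k.
  by rewrite mxE; apply/eqP; move: (w0 k); rewrite negbK.
case/existsP=> k; rewrite -(inord_val k); case: k => k ltk /=.
(* ij is the pair of indices of the k-th Pluecker coordinate. *)
pose ij := nth (0, 0)%N [:: (0, 1); (0, 2); (0, 3); (1, 2); (1, 3); (2, 3)]%N k.
exists ij.1, ij.2; first by rewrite /ij; case: k ltk {p ij} => [|[|[|[|[|[|]]]]]].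
exists (w 0 (inord k)) => //; apply: row_ext => m ltm.
rewrite [RHS]mxE pluckerE // /ij; move: sing; rewrite /klein_form.
case: k ltk {ij p} => [|[|[|[|[|[|]]]]]] //= _; rewrite !skew_row //=;
  case: m ltm => [|[|[|[|[|[|]]]]]] //= _;
  move: (w 0 (inord 0)) (w 0 (inord 1)) (w 0 (inord 2)) (w 0 (inord 3))
    (w 0 (inord 4)) (w 0 (inord 5)) => p0 p1 p2 p3 p4 p5 e;
  (* Each coordinate is a polynomial identity up to adding or subtracting the vanishing
     [klein_form w]. *)
  by [ring | rewrite -[LHS]addr0 -e; ring | rewrite -[LHS]subr0 -e; ring].
Qed.

Lemma plucker_neq0 u v : (plucker u v != 0) = free [:: v; u].
Proof.
rewrite free_cons span_seq1 seq1_free -negb_or; congr negb.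
apply/eqP/orP => [p0|[/vlineP[k ->]|/eqP->]].
- have [->|uN0] := eqVneq u 0; [by right | left].
  have /existsP[k uk] : [exists k : 'I_4, u 0 k != 0].
    apply: contraNT uN0; rewrite negb_exists => /forallP u0; apply/eqP/rowP=> k.
    by rewrite mxE; apply/eqP; move: (u0 k); rewrite negbK.
  have := skew_plucker u v (ltn_ord k); rewrite p0 inord_val.
  have -> : row k (skew 0) = 0.
    apply/rowP=> j; rewrite !mxE !oppr0.
    by case: k {uk} => [[|[|[|[|]]]] // ?]; case: j => [[|[|[|[|]]]] // ?].
  move/esym/eqP; rewrite subr_eq0 => /eqP e.
  by rewrite -[v](scalerK uk) e memvZ // memvZ // memv_line.
- have := plucker_comb u u 1 0 k 0; rewrite !scale0r !addr0 scale1r => ->.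
  by rewrite mulr0 mul0r subr0 scale0r.
have := plucker_comb v v 0 0 1 0; rewrite !scale0r !addr0 scale1r => ->.
by rewrite mulr0 mul0r subr0 scale0r.
Qed.

Lemma plucker_dim2 u v : plucker u v != 0 -> \dim (<[u]> + <[v]>) = 2%N.
Proof.
by rewrite plucker_neq0 /free span_cons span_seq1 addvC => /eqP.
Qed.

Lemma line_plucker_neq0 l : \dim l = 2%N -> plucker (vbasis l)`_0 (vbasis l)`_1 != 0.
Proof.
move=> dl; have := vbasisP l; have : size (vbasis l) = 2%N by rewrite size_tuple.
case: (tval (vbasis l)) => [|u [|v [|]]] // _ /andP[_ free_uv] /=.
by rewrite plucker_neq0 (perm_free (_ : perm_eq _ [:: u; v])) // (perm_catC [:: v] [:: u]).
Qed.

Lemma lineP l a : \dim l = 2%N ->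
  reflect (exists c d, a = c *: (vbasis l)`_0 + d *: (vbasis l)`_1) (a \in l).
Proof.
move=> dl; have := vbasisP l; have : size (vbasis l) = 2%N by rewrite size_tuple.
case: (tval (vbasis l)) => [|u [|v [|]]] // _ /andP[/eqP spanE _] /=.
rewrite -spanE span_cons span_seq1; apply: (iffP memv_addP).
  by case=> _ /vlineP[c ->] [_ /vlineP[d ->] ->]; exists c, d.
case=> c [d ->]; exists (c *: u); rewrite ?memvZ ?memv_line //.
by exists (d *: v); rewrite ?memvZ ?memv_line.
Qed.

Lemma vline_scale (vT : vectType F) (c : F) (x : vT) : c != 0 -> (<[c *: x]> = <[x]>)%VS.
Proof.
move=> cN0; apply/eqP; rewrite eqEsubv; apply/andP; split; rewrite -memvE.
  by rewrite memvZ // memv_line.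
by rewrite -[X in X \in _](scalerK cN0) memvZ // memv_line.
Qed.

Lemma klein_pointE l u v : \dim l = 2%N -> u \in l -> v \in l -> plucker u v != 0 ->
  klein_point l = <[plucker u v]>%VS.
Proof.
move=> dl /(lineP _ dl)[c [d ->]] /(lineP _ dl)[c' [d' ->]].
by rewrite plucker_comb scaler_eq0 negb_or => /andP[eN0 _]; rewrite vline_scale.
Qed.

Lemma line_eq l u v : \dim l = 2%N -> u \in l -> v \in l -> plucker u v != 0 ->
  l = (<[u]> + <[v]>)%VS.
Proof.
move=> dl ul vl /plucker_dim2 d2; apply/eqP; rewrite eq_sym eqEdim d2 dl leqnn andbT.
by rewrite subv_add -!memvE ul.
Qed.

Lemma klein_point_singular l : \dim l = 2%N ->
  exists2 w, klein_point l = <[w]>%VS & w != 0 /\ klein_form w = 0.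
Proof.
move=> /line_plucker_neq0 pN0.
by exists (plucker (vbasis l)`_0 (vbasis l)`_1) => //; rewrite plucker_singular.
Qed.

Lemma skew_in_line l w i : \dim l = 2%N -> klein_point l = <[w]>%VS ->
  (i < 4)%N -> row (inord i) (skew w) \in l.
Proof.
move=> dl lw lti.
have /vlineP[k ->] : w \in klein_point l by rewrite lw memv_line.
(* The factor [k] is absorbed into the first basis vector, so that [w] is itself a Pluecker vector
   of vectors of [l]. *)
have := plucker_comb (vbasis l)`_0 (vbasis l)`_1 k 0 0 1.
rewrite !scale0r addr0 add0r scale1r mulr1 mul0r subr0 => <-.
rewrite skew_plucker // rpredB // !rpredZ //; apply/(lineP _ dl).
  by exists 0, 1; rewrite scale0r add0r scale1r.
by exists 1, 0; rewrite scale0r addr0 scale1r.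
Qed.

(** Both lines are spanned by the same two rows of [skew w]. *)
Lemma klein_point_inj l l' : \dim l = 2%N -> \dim l' = 2%N ->
  klein_point l = klein_point l' -> l = l'.
Proof.
move=> dl dl' ll'; have [w lw [wN0 w0]] := klein_point_singular dl.
have [i [j /andP[lti ltj] [c cN0 pE]]] := plucker_skew wN0 w0.
have pN0 : plucker (row (inord i) (skew w)) (row (inord j) (skew w)) != 0.
  by rewrite pE scaler_eq0 negb_or cN0.
have l'w : klein_point l' = <[w]>%VS by rewrite -ll'.
rewrite (line_eq dl _ _ pN0) ?skew_in_line //.
by rewrite -(line_eq dl' _ _ pN0) ?skew_in_line.
Qed.

Lemma klein_point_surj w : w != 0 -> klein_form w = 0 ->
  exists2 l, \dim l = 2%N & klein_point l = <[w]>%VS.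
Proof.
move=> wN0 w0; have [i [j _ [c cN0 pE]]] := plucker_skew wN0 w0.
move: pE; set u := row _ _; set v := row _ _ => pE.
have pN0 : plucker u v != 0 by rewrite pE scaler_eq0 negb_or cN0.
have d2 := plucker_dim2 pN0; exists (<[u]> + <[v]>)%VS => //.
have ul : u \in (<[u]> + <[v]>)%VS by rewrite memvE addvSl.
have vl : v \in (<[u]> + <[v]>)%VS by rewrite memvE addvSr.
by rewrite (klein_pointE d2 ul vl pN0) pE vline_scale.
Qed.

(** * Incidence of lines and the polar form *)

Lemma klein_polE w w' : klein_pol w w' =
  w 0 (inord 0) * w' 0 (inord 5) + w 0 (inord 5) * w' 0 (inord 0)
  - w 0 (inord 1) * w' 0 (inord 4) - w 0 (inord 4) * w' 0 (inord 1)
  + w 0 (inord 2) * w' 0 (inord 3) + w 0 (inord 3) * w' 0 (inord 2).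
Proof. by rewrite /klein_pol /klein_form !mxE; ring. Qed.

Lemma klein_polZl (c : F) w w' : klein_pol (c *: w) w' = c * klein_pol w w'.
Proof. by rewrite !klein_polE !mxE; ring. Qed.

Lemma klein_polZr (c : F) w w' : klein_pol w (c *: w') = c * klein_pol w w'.
Proof. by rewrite !klein_polE !mxE; ring. Qed.

Lemma klein_pol_inter u v v' : klein_pol (plucker u v) (plucker u v') = 0.
Proof. by rewrite klein_polE !pluckerE //=; ring. Qed.

Lemma klein_pol_span u v a b (c d c' d' : F) :
  klein_pol (plucker u v) (plucker (c *: u + d *: v + a) (c' *: u + d' *: v + b))
    = klein_pol (plucker u v) (plucker a b).
Proof. by rewrite !klein_polE !pluckerE //= !mxE; ring. Qed.

Lemma klein_pol_nondeg w : (forall a b, klein_pol w (plucker a b) = 0) -> w = 0.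
Proof.
move=> w0; pose e i : 'rV[F]_4 := delta_mx 0 (inord i).
have eE i j : (i < 4)%N -> (j < 4)%N -> e i 0 (inord j) = (i == j)%:R.
  by move=> lti ltj; rewrite mxE eqxx /= -val_eqE /= !inordK // eq_sym.
have we i j := w0 (e i) (e j).
apply: row_ext => k ltk; rewrite [RHS]mxE.
(* The form pairs the k-th coordinate with the complementary pair of indices. *)
pose ij := nth (0, 0)%N [:: (2, 3); (1, 3); (1, 2); (0, 3); (0, 2); (0, 1)]%N k.
move: (we ij.1 ij.2); rewrite klein_polE !pluckerE //= !eE /ij //;
  case: k ltk {ij} => [|[|[|[|[|[|]]]]]] //= _;
  rewrite ?(oppr0, mulr0, mul0r, mulr1, subr0, sub0r, addr0, add0r) //.
all: by move/eqP; rewrite ?oppr_eq0 => /eqP.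
Qed.

Lemma line_complete l a : \dim l = 2%N -> a \in l -> a != 0 ->
  exists2 b, b \in l & plucker a b != 0.
Proof.
move=> dl /(lineP _ dl)[c [d ->]] aN0; have pN0 := line_plucker_neq0 dl.
move: aN0 pN0; have lP := lineP _ dl; set u := _`_0; set v := _`_1 => aN0 pN0.
have [d0|dN0] := eqVneq d 0.
  have cN0 : c != 0 by apply: contraNneq aN0 => c0; rewrite c0 d0 !scale0r addr0.
  exists v; first by apply/lP; exists 0, 1; rewrite scale0r scale1r add0r.
  have := plucker_comb u v c d 0 1; rewrite scale0r add0r scale1r => ->.
  by rewrite scaler_eq0 mulr1 mulr0 subr0 negb_or cN0.
exists u; first by apply/lP; exists 1, 0; rewrite scale0r scale1r addr0.
have := plucker_comb u v c d 1 0; rewrite scale0r addr0 scale1r => ->.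
by rewrite scaler_eq0 mulr1 mulr0 sub0r negb_or oppr_eq0 dN0.
Qed.

(** A common point can serve as first basis vector of both lines, and such Pluecker vectors are
    orthogonal. Disjoint lines span the space, and pairing the vector of [l] with [plucker a b] sees
    only the components of [a] and [b] in [l']; orthogonality would thus put that vector into the
    radical of a nondegenerate form. *)
Lemma line_meetP l l' w w' : \dim l = 2%N -> \dim l' = 2%N ->
    klein_point l = <[w]>%VS -> klein_point l' = <[w']>%VS ->
  (klein_pol w w' == 0) = ((l :&: l')%VS != 0%VS).
Proof.
move=> dl dl' lw lw'; apply/idP/idP => [/eqP ww'|meet].
  apply: contraTneq isT => disj.
  have full : (l + l')%VS = fullv.
    by apply/eqP; rewrite eqEdim subvf dimv_disjoint_sum // dl dl' dimvf leqnn.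
  have lP := lineP _ dl; have l'P := lineP _ dl'.
  have pN0 := line_plucker_neq0 dl.
  have /vlineP[k pE] : plucker (vbasis l)`_0 (vbasis l)`_1 \in <[w]>%VS.
    by rewrite -lw memv_line.
  have /vlineP[k' p'E] : plucker (vbasis l')`_0 (vbasis l')`_1 \in <[w']>%VS.
    by rewrite -lw' memv_line.
  case/eqP: pN0; apply: klein_pol_nondeg => a b.
  have /memv_addP[a1 /lP[c [d ->]] [a2 /l'P[e [f ->]] ->]] : a \in (l + l')%VS.
    by rewrite full memvf.
  have /memv_addP[b1 /lP[c' [d' ->]] [b2 /l'P[e' [f' ->]] ->]] : b \in (l + l')%VS.
    by rewrite full memvf.
  by rewrite klein_pol_span plucker_comb klein_polZr pE p'E klein_polZl klein_polZr ww' !mulr0.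
have := memv_pick (l :&: l')%VS; rewrite memv_cap => /andP[al al'].
have aN0 : vpick (l :&: l')%VS != 0 by rewrite vpick0.
have [b bl pN0] := line_complete dl al aN0; have [b' bl' p'N0] := line_complete dl' al' aN0.
have /vlineP[k ->] : w \in <[plucker (vpick (l :&: l')%VS) b]>%VS.
  by rewrite -(klein_pointE dl al bl pN0) lw memv_line.
have /vlineP[k' ->] : w' \in <[plucker (vpick (l :&: l')%VS) b']>%VS.
  by rewrite -(klein_pointE dl' al' bl' p'N0) lw' memv_line.
by rewrite klein_polZl klein_polZr klein_pol_inter !mulr0.
Qed.

End KleinCorrespondence.

(** * Spreads *)

Section Spreads.
Variable F : finFieldType.
Local Notation q := #|F|.
Implicit Types (u : 'rV[F]_4) (l m : {vspace 'rV[F]_4}).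

Lemma mem_points_on l u : u != 0 -> (<[u]>%VS \in points_on l) = (u \in l).
Proof. by move=> uN0; rewrite !inE dim_vline uN0 -memvE. Qed.

Lemma points_on_sub l m : points_on l \subset points_on m -> (l <= m)%VS.
Proof.
move=> /subsetP lm; apply/subvP=> u ul; have [->|uN0] := eqVneq u 0; first exact: mem0v.
by rewrite -mem_points_on // lm // mem_points_on.
Qed.

Lemma points_on_inj : injective (@points_on F).
Proof.
by move=> l m lm; apply/eqP; rewrite eqEsubv !points_on_sub // lm.
Qed.

Lemma sum_nonzero_mem (U : {vspace 'rV[F]_4}) :
  (\sum_(u : 'rV[F]_4 | u != 0%R) (u \in U) = (q ^ \dim U).-1)%N.
Proof.
rewrite -card_vspace -sum1_card [in RHS](bigD1 0) ?mem0v //=.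
by rewrite -big_mkcondl; apply: eq_bigl => u; rewrite andbC.
Qed.

Section FixedSpread.
Variable S : {set {vspace 'rV[F]_4}}.
Hypothesis spreadS : is_spread S.

Lemma spread_lines l : l \in S -> \dim l = 2%N.
Proof.
by case/andP: spreadS => /subsetP sub _ /sub; rewrite inE => /eqP.
Qed.

Lemma spread_cover u : u != 0 -> (\sum_(l in S) (u \in l) = 1)%N.
Proof.
move=> uN0; case/andP: spreadS => _ /and3P[/eqP covS /trivIsetP trivS _].
have : <[u]>%VS \in pg_points F by rewrite inE dim_vline uN0.
rewrite -covS => /bigcupP[_ /imsetP[l lS ->]]; rewrite mem_points_on // => ul.
rewrite (bigD1 l) //= ul big1 // => m /andP[mS ml]; case: (boolP (u \in m)) => // um.
have /trivS/(_ (imset_f _ mS)) := imset_f (@points_on F) lS.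
rewrite (inj_eq points_on_inj) eq_sym => /(_ ml)/disjoint_setI0/setP/(_ <[u]>%VS).
by rewrite in_setI in_set0 !mem_points_on // ul um.
Qed.

(** Each nonzero vector of [m] lies on exactly one line of the spread; both sides count these
    vectors. *)
Lemma spread_sum_mem m : (\sum_(l in S) (q ^ \dim (m :&: l)).-1 = (q ^ \dim m).-1)%N.
Proof.
rewrite -sum_nonzero_mem; under eq_bigr do rewrite -sum_nonzero_mem.
rewrite exchange_big /=; apply: eq_bigr => u uN0.
under eq_bigr do rewrite memv_cap.
case: (u \in m) => /=; last by rewrite big1.
exact: spread_cover.
Qed.

Lemma card_spread : #|S| = (q ^ 2 + 1)%N.
Proof.
have := spread_sum_mem fullv; rewrite dimvf.
under eq_bigr => l lS do rewrite capfv (spread_lines lS).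
rewrite sum_nat_const -[dim _]/4%N => e.
have q1 := finNzRing_gt1 F.
apply/eqP; rewrite -(@eqn_pmul2r (q ^ 2).-1) ?e; last by case: q q1 => [|[|k]].
by case: q q1 => // k _; rewrite /=; nia.
Qed.

Lemma dim_cap_lines l m : \dim l = 2%N -> \dim m = 2%N -> l != m ->
  \dim (m :&: l) = ((m :&: l)%VS != 0%VS).
Proof.
move=> dl dm lm; have [->|N0] := eqVneq (m :&: l)%VS 0%VS; first by rewrite dimv0.
have : (0 < \dim (m :&: l))%N by rewrite lt0n dimv_eq0.
have : (\dim (m :&: l) <= 2)%N by apply: leq_trans (dimvS (capvSl m l)) _; rewrite dm.
have : (\dim (m :&: l) != 2)%N; last by case: (\dim _) => [|[|[|]]].
apply: contraNneq lm => d2.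
have <- : (m :&: l)%VS = l by apply/eqP; rewrite eqEdim capvSr d2 dl.
by apply/eqP/eqP; rewrite eqEdim capvSl d2 dm.
Qed.

(** Outside the spread, each spread line meeting [m] takes q - 1 of its q^2 - 1 nonzero vectors. A
    line of the spread counts as meeting itself and already exhausts its own vectors. *)
Lemma sum_spread_meet m : \dim m = 2%N ->
  (\sum_(l in S) ((m :&: l)%VS != 0%VS) = if m \in S then 1 else q.+1)%N.
Proof.
move=> dm; have q1 := finNzRing_gt1 F; have := spread_sum_mem m; rewrite dm.
have capE l : l \in S -> l != m -> ((q ^ \dim (m :&: l)).-1 = q.-1 * ((m :&: l)%VS != 0%VS))%N.
  move=> lS lm; rewrite (dim_cap_lines (spread_lines lS) dm lm).
  by case: (_ != _); rewrite ?expn1 ?muln1 ?muln0.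
case: ifP => mS.
  rewrite !(bigD1 m mS) /= capvv dm -dimv_eq0 dm /= -[RHS]addn0 => /addnI e0.
  congr (_ + _)%N; move/eqP: e0; rewrite sum_nat_eq0 => /forall_inP e0.
  apply: big1 => l /andP[lS lm]; have := e0 l; rewrite lS lm => /(_ isT).
  rewrite capE // muln_eq0 -leqn0 leqNgt ltn_predRL q1 /=.
  by case: (_ != _).
rewrite (eq_bigr (fun l => q.-1 * ((m :&: l)%VS != 0%VS))%N) => [|l lS]; last first.
  by rewrite capE //; apply: contraFneq mS => <-.
rewrite -big_distrr /= => e.
apply/eqP; rewrite -(@eqn_pmul2l q.-1) ?ltn_predRL // e.
by case: q q1 => // k _; rewrite /=; nia.
Qed.

End FixedSpread.

(** With a = [#|A :&: S|], the double count reads (q^2 + 1) x (q + 1) + q^2 a = a + (x (q^2 + q + 1)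
    - a)(q + 1), that is, q (q + 1) a = q (q + 1) x. *)
Lemma cameron_liebler_criterion (A : {set {vspace 'rV[F]_4}}) x :
    A \subset pg_lines F -> (0 < x)%N -> #|A| = (x * (q ^ 2 + q + 1))%N ->
    (forall l, l \in pg_lines F ->
       #|[set m in A | (m :&: l)%VS != 0%VS]| = x * q.+1 + q ^ 2 * (l \in A))%N ->
  cameron_liebler A x.
Proof.
move=> Alines x0 cA meetA; split=> // S spreadS.
have dimA m : m \in A -> \dim m = 2%N.
  by move/(subsetP Alines); rewrite inE => /eqP.
have sumS : (\sum_(l in S) \sum_(m in A) ((m :&: l)%VS != 0%VS)
    = #|S| * (x * q.+1) + q ^ 2 * #|A :&: S|)%N.
  transitivity (\sum_(l in S) (x * q.+1 + q ^ 2 * (l \in A)))%N.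
    apply: eq_bigr => l lS; rewrite -meetA ?inE ?(spread_lines spreadS) //.
    by rewrite -sum1dep_card big_mkcondr /=; apply: eq_bigr => m _; case: eqP.
  rewrite big_split /= sum_nat_const -big_distrr /=; congr (_ + _ * _)%N.
  rewrite setIC -sum1_card; under [RHS]eq_bigl do rewrite in_setI.
  by rewrite [RHS]big_mkcondr /=; apply: eq_bigr => l _; case: (l \in A).
have sumA : (\sum_(m in A) \sum_(l in S) ((m :&: l)%VS != 0%VS)
    = #|A :&: S| + #|A :\: S| * q.+1)%N.
  rewrite (big_setID S) /= -sum1_card -sum_nat_const.
  congr (_ + _)%N; apply: eq_bigr => m; rewrite !inE => /andP[].
    by move=> mA mS; rewrite sum_spread_meet ?dimA // mS.
  by move=> /negPf mS mA; rewrite sum_spread_meet ?dimA // mS.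
have := cardsID S A; rewrite cA.
move: sumS; rewrite exchange_big /= sumA (card_spread spreadS).
set a := #|A :&: S|; set b := #|A :\: S| => e1 e2.
have q1 := finNzRing_gt1 F.
apply/eqP; rewrite -(@eqn_pmul2l (q * q.+1)) ?muln_gt0 ?(ltnW q1) //.
move: e1 (congr1 (muln q.+1) e2); rewrite !expnS expn0 muln1.
by move: (#|F|) => k e1 e3; apply/eqP; nia.
Qed.

End Spreads.

Lemma card_setX_fiber (T1 T2 : finType) (A1 : {set T1}) (A2 : {set T2})
    (P : pred (T1 * T2)) :
  (#|[set p in setX A1 A2 | P p]| = \sum_(t in A2) #|[set s in A1 | P (s, t)]|)%N.
Proof.
transitivity (\sum_(t in A2) \sum_(s in A1 | P (s, t)) 1)%N; last first.
  by apply: eq_bigr => t _; rewrite sum1dep_card.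
rewrite (exchange_big_dep (mem A1)) /=; last by move=> t s _ /andP[].
rewrite pair_big_dep -sum1dep_card; apply: eq_bigl => -[s t] /=.
by rewrite in_setX; case: (s \in A1); rewrite /= ?andbF.
Qed.

(** * The cubic extension *)

Section Frobenius.
Variables (F : finFieldType) (L : fieldExtType F).
Local Notation K := (finvect_type L).
Local Notation q := #|F|.

Definition frob (x : K) : K := x ^+ q.

(** Identifying Frobenius with a Galois automorphism gives its additivity and linearity, and reduces
    Galois sums and products to its powers. *)
Lemma gal_frob : exists2 s : gal_of {:K},
  'Gal({: K} / 1)%g = <[s]>%g & forall x, s x = frob x.
Proof.
have [s gen_s sE] := finField_galois_generator (sub1v {:K}%AS).
exists s; first exact/eqP.
by move=> x; rewrite sE ?memvf //= dimv1 expn1.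
Qed.

Lemma frob_zmod_morphism : zmod_morphism frob.
Proof. by have [s _ sE] := gal_frob; move=> x y; rewrite -!sE rmorphB. Qed.

Lemma frob_monoid_morphism : monoid_morphism frob.
Proof.
by split=> [|x y]; rewrite /frob ?expr1n ?exprMn.
Qed.

HB.instance Definition _ :=
  GRing.isZmodMorphism.Build K K frob frob_zmod_morphism.
HB.instance Definition _ :=
  GRing.isMonoidMorphism.Build K K frob frob_monoid_morphism.

Lemma frob_scalar (a : F) : frob a%:A = a%:A.
Proof. by have [s _ sE] := gal_frob; rewrite -sE linearZ /= rmorph1. Qed.

Lemma frobZ (a : F) x : frob (a *: x) = a *: frob x.
Proof. by rewrite -mulr_algl rmorphM /= frob_scalar mulr_algl. Qed.

Lemma frob_frob x : frob (frob x) = x ^+ (q ^ 2).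
Proof. by rewrite /frob -exprM. Qed.

Lemma frob_fixed x : frob x = x -> exists a : F, x = a%:A.
Proof.
move=> fx; have [s galE sE] := gal_frob.
have /galois_fixedField := finField_galois (sub1v {:K}%AS) => fixE.
have: x \in (1%VS : {vspace K}).
  rewrite -fixE; apply/fixedFieldP; first exact: memvf.
  move=> t; rewrite galE => /cycleP[n ->].
  elim: n => [|n IHn]; first by rewrite expg0 gal_id.
  by rewrite expgSr galM ?memvf // IHn sE.
by case/vlineP=> a ->; exists a.
Qed.

End Frobenius.

Section CubicField.
Variables (F : finFieldType) (L : fieldExtType F).
Hypothesis dimL : \dim {: L} = 3%N.
Local Notation K := (finvect_type L).
Local Notation q := #|F|.
Local Notation frob := (@frob F L).

Lemma cardK : #|K| = (q ^ 3)%N.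
Proof.
have := card_vspace (T := K) {: K}; rewrite card_vspacef => ->.
by congr (_ ^ _)%N.
Qed.

Lemma frob3 x : frob (frob (frob x)) = x.
Proof.
have -> : frob (frob (frob x)) = x ^+ #|K|.
  by rewrite /frob -!exprM cardK !expnS muln1.
exact: expf_card.
Qed.

(** The Galois group consists of the three powers of Frobenius; a general commutative law covers
    trace and norm at once. *)
Lemma big_gal (R : Type) (idx : R) (op : Monoid.com_law idx) (G : K -> R) x :
  \big[op/idx]_(s in 'Gal({: K} / 1)%g) G (s x)
    = op (op (G x) (G (frob x))) (G (frob (frob x))).
Proof.
have [s galE sE] := @gal_frob F L.
have := galois_dim (finField_galois (sub1v {:K}%AS)).
have -> : \dim {: K} = 3 by exact: dimL.
rewrite dimv1 divn1 => o3; rewrite galE.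
have ords : #[s]%g = 3 by rewrite /order -galE -o3.
have powsE : [set s ^+ i | i : 'I_3]%g = <[s]>%g.
  apply/setP=> t; apply/imsetP/idP => [[i _ ->]|]; first exact: mem_cycle.
  by case/cyclePmin=> i; rewrite ords => lti ->; exists (Ordinal lti).
rewrite -powsE big_imset /=; last first.
  by apply/imset_injP; rewrite powsE card_ord -[#|_|]/(#[s]%g) ords.
rewrite !big_ord_recl big_ord0 /= expg0 expg1 expgS expg1 gal_id !galM ?memvf //.
by rewrite !sE Monoid.mulm1 Monoid.mulmA.
Qed.

Definition tr (x : K) : K := x + frob x + frob (frob x).
Definition nm (x : K) : K := x * frob x * frob (frob x).

Lemma to_baseK (a : F) : to_base (a%:A : K) = a.
Proof.
rewrite /to_base; case: pickP => [b /eqP/(fmorph_inj (in_alg K)) // | /(_ a)].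
by rewrite eqxx.
Qed.

Lemma trKE x : (trK x)%:A = tr x.
Proof.
have trE : galTrace 1 fullv x = tr x by rewrite /galTrace (big_gal _ id).
rewrite /trK trE.
have [|a ->] := @frob_fixed F L (tr x); last by rewrite to_baseK.
by rewrite /tr !rmorphD /= frob3; ring.
Qed.

Lemma normKE x : (normK x)%:A = nm x.
Proof.
have nmE : galNorm 1 fullv x = nm x by rewrite /galNorm (big_gal _ id).
rewrite /normK nmE.
have [|a ->] := @frob_fixed F L (nm x); last by rewrite to_baseK.
by rewrite /nm !rmorphM /= frob3; ring.
Qed.

Hypothesis q_mod3 : (q = 2 %[mod 3])%N.
Implicit Types (x y z u v w m b : K).

(** In characteristic 3 the element 1 would have additive order 3, which would divide q. *)
Lemma three_neq0 : 3%:R != 0 :> F.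
Proof.
apply/negP=> /eqP three0.
have ord1 : #[1%R : F]%g = 3%N.
  apply/prime_nt_dvdP => //; last by rewrite order_dvdn; apply/eqP.
  by rewrite order_eq1 -[_ == _]/(1 == 0 :> F) oner_eq0.
have := order_dvdG (in_setT (1%R : F)).
by rewrite ord1 cardsT /dvdn q_mod3.
Qed.

(** A cube root of unity z in [F] satisfies z = z^q = z^2, as q = 2 mod 3, hence z = 1. *)
Lemma cube_inj : injective (fun y : F => y ^+ 3).
Proof.
move=> x y /= xy3; have [y0|yN0] := eqVneq y 0.
  by apply/eqP; move/eqP: xy3; rewrite y0 expr0n /= expf_eq0.
have xN0 : x != 0.
  by apply: contra_neq yN0 => x0; apply/eqP; rewrite -[_ == 0](expf_eq0 y 3) -xy3 x0 expr0n.
have z3 : (x / y) ^+ 3 = 1 by rewrite expr_div_n xy3 divff // expf_neq0.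
have zN0 : x / y != 0 by rewrite mulf_neq0 ?invr_neq0.
suff z1 : x / y = 1 by rewrite -[x](divfK yN0) z1 mul1r.
have := expf_card (x / y); rewrite (divn_eq q 3) q_mod3 exprD mulnC exprM z3.
rewrite expr1n mul1r -[(2 %% 3)%N]/2%N expr2 => /(congr1 (fun t => t / (x / y))).
by rewrite mulfK // divff.
Qed.

Lemma cbrtK (a : F) : cbrt a ^+ 3 = a.
Proof. exact: f_finv cube_inj a. Qed.

Lemma cbrt_eq0 (a : F) : (cbrt a == 0) = (a == 0).
Proof. by rewrite -[in RHS](cbrtK a) expf_eq0 andTb. Qed.

(** * Norm, trace and the elements of norm 1 *)

Lemma nmM x y : nm (x * y) = nm x * nm y.
Proof. by rewrite /nm !rmorphM; ring. Qed.

Lemma nmZ (a : F) x : nm (a *: x) = a ^+ 3 *: nm x.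
Proof.
by rewrite /nm !frobZ -!scalerAl -!scalerAr -!scalerAl !scalerA !exprS mulr1 mulrA.
Qed.

Lemma nm_eq0 x : (nm x == 0) = (x == 0).
Proof. by rewrite /nm !mulf_eq0 !fmorph_eq0 !orbb. Qed.

Lemma trD x y : tr (x + y) = tr x + tr y.
Proof. by rewrite /tr !rmorphD /=; ring. Qed.

Lemma trZ (a : F) x : tr (a *: x) = a *: tr x.
Proof. by rewrite /tr !frobZ !scalerDr. Qed.

Lemma tr0 : tr (0 : K) = 0.
Proof. by rewrite /tr !rmorph0 !addr0. Qed.

(* This is C0: the only subgroup of order q^2+q+1 is the kernel of the norm. *)
Definition normone : {set K} := [set x | nm x == 1].

Lemma normone_neq0 x : x \in normone -> x != 0.
Proof. by rewrite inE -nm_eq0 => /eqP->; apply: oner_neq0. Qed.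

Lemma normone_1 : 1 \in normone.
Proof. by rewrite inE /nm !rmorph1 !mulr1. Qed.

Lemma normoneM x y : x \in normone -> y \in normone -> x * y \in normone.
Proof. by rewrite !inE nmM => /eqP-> /eqP->; rewrite mulr1. Qed.

Lemma normoneV x : x \in normone -> x^-1 \in normone.
Proof. by rewrite !inE /nm !fmorphV -!invfM -/(nm x) => /eqP->; rewrite invr1. Qed.

Lemma normone_inv x : x \in normone -> x^-1 = frob x * frob (frob x).
Proof.
move=> x1; apply: (mulfI (normone_neq0 x1)); rewrite divff ?normone_neq0 //.
by move: x1; rewrite inE mulrA => /eqP.
Qed.

(** A scalar [c] has norm [c ^+ 3], so dividing [x] by the cube root of its norm leaves norm 1. As
    cubing is injective on [F], K^* is the direct product of F^* and [normone]. *)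
Lemma normone_scale x : x != 0 ->
  exists c : F, exists2 y, y \in normone & c != 0 /\ x = c *: y.
Proof.
rewrite -nm_eq0 -normKE scaler_eq0 oner_eq0 orbF => nx.
have cN0 : cbrt (normK x) != 0 by rewrite cbrt_eq0.
exists (cbrt (normK x)), ((cbrt (normK x))^-1 *: x); last first.
  by rewrite scalerA divff // scale1r.
by rewrite inE nmZ exprVn cbrtK -normKE scalerA mulVf // scale1r.
Qed.

Lemma normone_scale_inj (c d : F) x y :
  x \in normone -> y \in normone -> c *: x = d *: y -> c = d.
Proof.
rewrite !inE => /eqP nx /eqP ny /(congr1 (fun t : K => nm t)); rewrite !nmZ nx ny.
by move/(fmorph_inj (in_alg K))/cube_inj.
Qed.

(** Such a cone is the disjoint union of the q - 1 nonzero scalar multiples of its norm 1 slice. *)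
Lemma card_cone (A : {set K}) :
    (forall (c : F) x, c != 0 -> x \in A -> c *: x \in A) -> 0 \notin A ->
  #|A| = (q.-1 * #|A :&: normone|)%N.
Proof.
move=> coneA A0.
have AE : A = (fun p : F * K => p.1 *: p.2) @: setX [set~ 0] (A :&: normone).
  apply/setP=> x; apply/idP/imsetP => [Ax|[[c y] /=]]; last first.
    by rewrite !inE /= => /and3P[cN0 Ay _] ->; apply: coneA.
  have [|c [y y1 [cN0 xE]]] := @normone_scale x.
    by apply: contraNneq A0 => <-.
  exists (c, y); rewrite ?xE // in_setX in_setI y1 in_setC1 cN0 andbT /=.
  have -> : y = c^-1 *: x by rewrite xE scalerA mulVf // scale1r.
  by rewrite coneA ?invr_neq0.
rewrite [in LHS]AE card_in_imset.
  by rewrite cardsX cardsC1.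
case=> [c x] [d y]; rewrite !inE /= => /and3P[cN0 _ x1] /and3P[_ _ y1] eqxy.
have ecd : c = d by apply: normone_scale_inj eqxy; rewrite inE.
by move: eqxy; rewrite -ecd => /(scalerI cN0) ->.
Qed.

Lemma card_normone : #|normone| = (q ^ 2 + q + 1)%N.
Proof.
have := @card_cone [set~ 0]; rewrite cardsC1 cardK (setIidPr _); last first.
  by apply/subsetP=> x /normone_neq0; rewrite !inE.
move=> coneK; apply/eqP; rewrite -(@eqn_pmul2l q.-1) ?ltn_predRL ?(finNzRing_gt1 F) //.
rewrite -coneK ?inE ?eqxx // => [|c x].
  by have := (finNzRing_gt1 F); case: q => // n _; rewrite /=; nia.
by rewrite !inE scaler_eq0 negb_or => ->.
Qed.

(** * The map [delta] and the trace 0 elements *)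

Definition delta (x : K) : K := frob x - frob (frob x).

Lemma delta_zmod_morphism : zmod_morphism delta.
Proof. by move=> x y; rewrite /delta !rmorphB /=; ring. Qed.

HB.instance Definition _ := GRing.isZmodMorphism.Build K K delta delta_zmod_morphism.

Lemma deltaZ (a : F) x : delta (a *: x) = a *: delta x.
Proof. by rewrite /delta !frobZ scalerBr. Qed.

Lemma delta_scalar (a : F) : delta a%:A = 0.
Proof. by rewrite /delta !frob_scalar subrr. Qed.

Lemma tr_delta x : tr (delta x) = 0.
Proof. by rewrite /delta /tr !rmorphB /= !frob3; ring. Qed.

Lemma delta_delta x : delta (delta x) = tr x - 3%:R *: x.
Proof. by rewrite /delta /tr !rmorphB /= !frob3 scaler_nat; ring. Qed.

Definition tr0_set : {set K} := [set x | tr x == 0].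

Lemma sum_delta (f : K -> nat) :
  (\sum_u f (delta u) = q * \sum_(z in tr0_set) f z)%N.
Proof.
(* On trace 0 elements delta o delta is -3, so delta is inverted by beta delta. *)
pose h (p : F * K) : K := p.1%:A + (beta F *: delta p.2).
pose h' (u : K) : F * K := (3%:R^-1 * trK u, delta u).
have hK u : h (h' u) = u.
  rewrite /h /h' /= delta_delta scalerBr scalerA -[X in X + _]scalerA trKE.
  by rewrite /beta scaleNr mulNr mulVf ?three_neq0 // scaleNr opprK scale1r addrA subrr add0r.
have trh p : trK (h p) = 3%:R * p.1.
  apply: (fmorph_inj (in_alg K)); rewrite /= trKE /h trD trZ tr_delta scaler0 addr0.
  by rewrite trZ /tr !rmorph1 [3%:R * _]mulrC -scalerA scaler_nat; congr (_ *: _); ring.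
have deltah p : (delta (h p) == p.2) = (p.2 \in tr0_set).
  rewrite /h raddfD /= delta_scalar add0r deltaZ delta_delta scalerBr scalerA.
  rewrite /beta mulNr mulVf ?three_neq0 // !scaleNr opprK scale1r inE.
  by rewrite -subr_eq0 addrK oppr_eq0 scaler_eq0 invr_eq0 (negPf three_neq0).
have delta_h p : p.2 \in tr0_set -> delta (h p) = p.2 by rewrite -deltah => /eqP.
(* The reindexing keeps the pairs [p] with [h' (h p) = p], which are those whose second component
   has trace 0; the first component runs freely over the q scalars. *)
rewrite (reindex_onto h h') => [|u _]; last exact: hK.
transitivity (\sum_(a : F) \sum_(z in tr0_set) f z); last by rewrite sum_nat_const.
rewrite pair_big /=; apply: eq_big => [[a z]|[a z]] /=.
  rewrite /h' trh /= mulrA mulVf ?three_neq0 // mul1r.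
  by rewrite -pair_eqE /= eqxx (deltah (a, z)).
by rewrite /h' -pair_eqE /= (deltah (a, z)) => /andP[_ /(delta_h (a, z)) ->].
Qed.

Lemma card_tr0 : #|tr0_set| = (q ^ 2)%N.
Proof.
have := sum_delta (fun=> 1%N); rewrite !sum1_card cardK expnS => /eqP.
by rewrite eqn_pmul2l ?(ltnW (finNzRing_gt1 F)) // => /eqP <-.
Qed.

(** The nonzero [w] with [tr (w * a) = 0] form a cone of q^2 - 1 elements, so its norm 1 slice has q
    + 1. *)
Lemma card_orth a : a != 0 -> #|[set m in normone | tr (m * a) == 0]| = q.+1.
Proof.
move=> aN0; pose A := [set w : K | (w != 0) && (tr (w * a) == 0)].
have := @card_cone A; rewrite inE eqxx /= => /(_ _ isT) cA.
have AE : A = (fun z => z / a) @: (tr0_set :\ 0).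
  apply/setP=> w; apply/idP/imsetP => [|[z]]; rewrite !inE.
    by case/andP=> wN0 w0; exists (w * a); rewrite ?mulfK // !inE mulf_neq0.
  by case/andP=> zN0 z0 ->; rewrite mulf_neq0 ?invr_neq0 //= divfK.
have -> : [set m in normone | tr (m * a) == 0] = A :&: normone.
  apply/setP=> m; rewrite !inE; apply/andP/andP => [[m1 ma]|[/andP[_ ma] m1]] //.
  by rewrite normone_neq0 ?inE.
apply/eqP; rewrite -(@eqn_pmul2l q.-1) ?ltn_predRL ?(finNzRing_gt1 F) // -cA.
  rewrite AE card_imset; last by move=> z w /(mulIf (invr_neq0 aN0)).
  have := cardsD1 0 tr0_set; rewrite card_tr0 inE tr0 eqxx /= => q2.
  by have := (finNzRing_gt1 F); move: q2; set n := #|_ :\ _|; case: q => // k; nia.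
move=> c w cN0; rewrite !inE scaler_eq0 negb_or cN0 /= => /andP[-> /eqP w0].
by rewrite -scalerAl trZ w0 scaler0 eqxx.
Qed.

(** The number of points <(m, m^-1 z)> in the orbit of <(1, z)> that are orthogonal to <(1, b)> for
    the polar form of [Q]. *)
Definition kap (z b : K) : nat := #|[set m in normone | tr (m^-1 * z + m * b) == 0]|.

Lemma kap_sum z b : kap z b = (\sum_(m in normone) (tr (m^-1 * z + m * b) == 0)%R)%N.
Proof.
by rewrite /kap -sum1dep_card big_mkcondr /=; apply: eq_bigr => m _; case: ifP.
Qed.

Lemma tr_kap_delta m w b : m \in normone ->
  tr (m^-1 * delta (w / m) + m * b) = tr (m * (b - delta w)).
Proof.
move=> m1; rewrite normone_inv // /delta /tr.
have e : m * frob m * frob (frob m) - 1 = 0.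
  by apply/eqP; rewrite subr_eq0; move: m1; rewrite inE.
rewrite !(rmorphD, rmorphN, rmorphM) /= !frob3.
move: e; move: (frob m) (frob (frob m)) (frob w) (frob (frob w)) (frob b) (frob (frob b)).
move=> m' m'' w' w'' b' b'' e; apply/eqP; rewrite -subr_eq0; apply/eqP.
(* With m^-1 = m' m'', the difference of the two sides is this multiple of the norm relation. *)
transitivity ((m * m' * m'' - 1)
  * (m'' * w' - m' * w'' + m * w'' - m'' * w + m' * w - m * w')).
  by ring.
by rewrite e mul0r.
Qed.

(** Closure of [U] under [normone] permits the substitution u = w / m for each fixed m; [card_orth]
    then counts the m for each w. It serves for the whole field and for [normone]. *)
Lemma sum_kap_delta (U : {set K}) b :
    (forall u m, u \in U -> m \in normone -> u * m \in U) ->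
  (\sum_(u in U) kap (delta u) b
    = #|U| * q.+1 + q ^ 2 * #|[set u in U | delta u == b]|)%N.
Proof.
move=> U1; under eq_bigr do rewrite kap_sum.
rewrite exchange_big /=.
transitivity (\sum_(m in normone) \sum_(w in U) (tr (m * (b - delta w)) == 0)%R)%N.
  apply: eq_bigr => m m1.
  have mN0 := normone_neq0 m1.
  rewrite (reindex_onto (fun w => w / m) (fun u => u * m)) /=; last first.
    by move=> u _; rewrite mulfK.
  apply: eq_big => [w|w _]; last by rewrite tr_kap_delta.
  rewrite divfK // eqxx andbT; apply/idP/idP => [/U1/(_ m1)|/U1/(_ (normoneV m1))//].
  by rewrite divfK.
rewrite exchange_big /=.
transitivity (\sum_(w in U) (q.+1 + q ^ 2 * (delta w == b)))%N.
  apply: eq_bigr => w _.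
  have [dwb|dwb] := eqVneq (delta w) b.
    rewrite dwb subrr muln1; under eq_bigr do rewrite mulr0 tr0 eqxx.
    by rewrite sum_nat_const card_normone; nia.
  rewrite muln0 addn0 -(@card_orth (b - delta w)) ?subr_eq0 1?eq_sym //.
  rewrite -sum1dep_card big_mkcondr /=; apply: eq_bigr => m _; by case: ifP.
rewrite big_split /= sum_nat_const -big_distrr /=; congr (_ + _ * _)%N.
by rewrite -sum1dep_card big_mkcondr /=; apply: eq_bigr => w _; case: ifP.
Qed.

(** * Sums of [kap] over the trace 0 elements, [D2] and [D1] *)

Lemma L0E x : (x \in L0 L) = (x \in normone) && (tr x == 0).
Proof.
have scal (a b : F) : (a == b) = (a%:A == b%:A :> K).
  by rewrite (inj_eq (fmorph_inj (in_alg K))).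
rewrite !inE !scal trKE normKE scale0r scale1r andbC.
by case: eqP => //= n1; rewrite normone_neq0 // inE n1.
Qed.

Lemma T0E x : (x \in T0 L) = (x != 0) && (x \in tr0_set).
Proof.
have scal (a b : F) : (a == b) = (a%:A == b%:A :> K).
  by rewrite (inj_eq (fmorph_inj (in_alg K))).
by rewrite !inE !scal trKE scale0r.
Qed.

Lemma card_L0 : #|L0 L| = q.+1.
Proof.
rewrite -(card_orth (oner_neq0 K)).
by apply: eq_card => m; rewrite L0E !inE mulr1.
Qed.

Lemma card_delta_fiber b : b \in tr0_set -> #|[set u in [set: K] | delta u == b]| = q.
Proof.
move=> b0; have : (\sum_(z in tr0_set) (z == b) = 1)%N.
  by rewrite (bigD1 b) //= eqxx big1 // => z /andP[_ /negPf->].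
have := sum_delta (fun z => z == b) => /= + s1; rewrite s1.
rewrite muln1 => <-; rewrite -sum1dep_card big_mkcond /=.
by apply: eq_bigr => u _; rewrite in_setT /=; case: eqP.
Qed.

(** On the whole field [delta] takes each trace 0 value q times, so q times the sum is q^3 (q + 1) +
    q^2 q. *)
Lemma sum_kap_tr0 b : b \in tr0_set ->
  (\sum_(z in tr0_set) kap z b = q ^ 3 + 2 * q ^ 2)%N.
Proof.
move=> b0; apply/eqP; rewrite -(@eqn_pmul2l q) ?(ltnW (finNzRing_gt1 F)) // -sum_delta.
have := @sum_kap_delta [set: K] b (fun _ _ _ _ => in_setT _).
rewrite cardsT cardK card_delta_fiber // => sumE.
transitivity (\sum_(u in [set: K]) kap (delta u) b == q * (q ^ 3 + 2 * q ^ 2))%N.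
  by congr (_ == _); apply: eq_bigl => u; rewrite inE.
by rewrite sumE; apply/eqP; nia.
Qed.

Lemma kap0 b : b != 0 -> kap 0 b = q.+1.
Proof.
move=> bN0; rewrite -(card_orth bN0); apply: eq_card => m.
by rewrite !inE mulr0 add0r.
Qed.

Lemma kapZ (k : F) z b : k != 0 -> kap (k *: z) (k *: b) = kap z b.
Proof.
move=> kN0; apply: eq_card => m; rewrite !inE -!scalerAr -scalerDr trZ.
by rewrite scaler_eq0 (negPf kN0).
Qed.

(** The substitution of x / (y m) for m exchanges m^-1 x and m y. *)
Lemma kap_swap (t r : F) x y : x \in normone -> y \in normone ->
  kap (t *: x) (r *: y) = kap (r *: x) (t *: y).
Proof.
move=> x1 y1; have [xN0 yN0] := (normone_neq0 x1, normone_neq0 y1).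
pose h m := x / y / m.
have hK m : h (h m) = m by rewrite /h invf_div mulrC divfK // mulf_neq0 ?invr_neq0.
have h1 m : (h m \in normone) = (m \in normone).
  have hm k : k \in normone -> h k \in normone.
    by move=> k1; rewrite /h !normoneM ?normoneV.
  by apply/idP/idP => [/hm|/hm //]; rewrite hK.
rewrite !kap_sum (reindex_inj (can_inj hK)) /=; apply: eq_big => m; rewrite h1 // => m1.
have mN0 := normone_neq0 m1.
rewrite /h -!scalerAr !trD !trZ addrC.
by congr ((_ *: tr _ + _ *: tr _ == 0)%R : nat); field; rewrite ?mN0 ?xN0 ?yN0.
Qed.

Section NormalizedElement.
Variables (x : K) (lam : F).
Hypothesis xL0 : x \in L0 L.

Definition cD : F := cbrt (normD x lam).
(** The element lam + x^q - x^(q^2) scaled to norm 1; [delta] sends it to the entry of [D2] indexed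
    by (x, lam). *)
Definition wD : K := cD^-1 *: (lam%:A + delta x).

(** On trace 0 elements [delta] applied twice is multiplication by -3, the inverse of [beta]. *)
Lemma delta_uD : delta (lam%:A + delta x) = (beta F)^-1 *: x.
Proof.
rewrite raddfD /= delta_scalar add0r delta_delta.
have /andP[_ /eqP->] : (x \in normone) && (tr x == 0) by rewrite -L0E.
by rewrite sub0r /beta invrN invrK scaleNr.
Qed.

Lemma cD3 : (cD ^+ 3)%:A = nm (lam%:A + delta x).
Proof. by rewrite /cD cbrtK /normD normKE -frob_frob addrA. Qed.

(** The norm vanishes only if lam + delta x = 0, but [delta] sends this element to -3 x, which is
    nonzero. *)
Lemma cD_neq0 : cD != 0.
Proof.
rewrite /cD cbrt_eq0 -(inj_eq (fmorph_inj (in_alg K))) /= scale0r.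
rewrite /normD normKE nm_eq0 -frob_frob -addrA -/(delta x).
apply/eqP=> u0; have := delta_uD; rewrite u0 raddf0 => /esym/eqP.
rewrite scaler_eq0 invr_eq0 oppr_eq0 invr_eq0 (negPf three_neq0) /=.
by move: xL0; rewrite L0E => /andP[/normone_neq0/negPf->].
Qed.

Lemma wD_normone : wD \in normone.
Proof.
rewrite inE /wD nmZ -cD3 scalerA exprVn mulVf ?scale1r //.
by rewrite expf_neq0 // cD_neq0.
Qed.

Lemma delta_wD : delta wD = ((beta F)^-1 * cD^-1) *: x.
Proof. by rewrite /wD deltaZ delta_uD scalerA mulrC. Qed.

End NormalizedElement.

(** Applying [delta] gives an equality of multiples of the norm 1 elements [x] and [y]: the scalars
    agree, then [x] and [y], and cancelling the scalar leaves [a = b]. *)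
Lemma wD_inj x y (a b : F) : x \in L0 L -> y \in L0 L ->
  wD x a = wD y b -> x = y /\ a = b.
Proof.
move=> xL0 yL0 wE; have := congr1 (fun w : K => delta w) wE.
rewrite /= !delta_wD // => xyE.
have [] := (xL0, yL0); rewrite !L0E => /andP[x1 _] /andP[y1 _].
have cxy := normone_scale_inj x1 y1 xyE.
have betaN0 : (beta F)^-1 != 0 by rewrite invr_eq0 oppr_eq0 invr_eq0 three_neq0.
have xy : x = y.
  move: xyE; rewrite cxy; apply: scalerI.
  by rewrite mulf_neq0 // invr_eq0 cD_neq0.
split=> //; move: wE; rewrite /wD -(invr_inj (mulfI betaN0 cxy)) -xy.
move/(scalerI _); rewrite invr_eq0 cD_neq0 // => /(_ isT)/addIr.
exact: (fmorph_inj (in_alg K)).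
Qed.

(* Injectivity gives q(q+1) values wD x lam, which is the size of the target. *)
Lemma imset_wD :
  [set wD p.1 p.2 | p in setX (L0 L) [set: F]] = normone :\ 1.
Proof.
apply/eqP; rewrite eqEcard; apply/andP; split.
  apply/subsetP=> _ /imsetP[[x a] /setXP[xL0 _] ->] /=.
  rewrite in_setD1 wD_normone // andbT; apply/eqP=> w1.
  have := delta_wD a xL0; rewrite w1 -[1]scale1r delta_scalar => /esym/eqP.
  rewrite scaler_eq0 mulf_eq0 !invr_eq0 oppr_eq0 invr_eq0 (negPf three_neq0).
  rewrite (negPf (cD_neq0 a xL0)) /=.
  by move: xL0; rewrite L0E => /andP[/normone_neq0/negPf->].
rewrite card_in_imset; last first.
  move=> [x a] [y b] /setXP[/= xL0 _] /setXP[/= yL0 _] /(wD_inj xL0 yL0)[-> ->] //.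
have := cardsD1 1 normone; rewrite normone_1 card_normone cardsX card_L0 cardsT.
by rewrite add1n addn1 => -[<-]; rewrite mulSn expnS expn1 addnC.
Qed.

(** The extra term [f 0] belongs to w = 1, the one element of [normone] that is not of the form
    [wD x lam]. *)
Lemma sum_D2 (f : K -> nat) :
  (\sum_(z <- D2 L) f z + f 0%R = \sum_(w in normone) f (delta w))%N.
Proof.
rewrite [RHS](big_setD1 1) ?normone_1 //= addnC; congr (_ + _)%N.
  by rewrite -[1 in RHS]scale1r delta_scalar.
rewrite -imset_wD big_imset /=; last first.
  by move=> [x a] [y b] /setXP[/= xL0 _] /setXP[/= yL0 _] /(wD_inj xL0 yL0)[-> ->].
rewrite /D2 big_allpairs_dep /= big_enum /=.
under eq_bigr do rewrite big_enum /=.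
rewrite pair_big /=; apply: eq_big => [[x a]|[x a] /andP[xL0 _]] /=.
  by rewrite !inE !andbT.
by rewrite delta_wD.
Qed.

Lemma count_sum (s : seq K) z : count_mem z s = (\sum_(y <- s) (y == z))%N.
Proof. by elim: s => [|y s IHs] /=; rewrite ?big_nil // big_cons IHs. Qed.

Lemma sum_kap_D2 b : b != 0 ->
  (\sum_(z <- D2 L) kap z b
    = q ^ 3 + 2 * q ^ 2 + q + q ^ 2 * count_mem b (D2 L))%N.
Proof.
move=> bN0; have := sum_D2 (fun z => kap z b); rewrite kap0 //.
have := sum_D2 (fun z => z == b); rewrite [0 == b]eq_sym (negPf bN0) addn0.
rewrite count_sum sum_kap_delta => [cE|u m u1 m1]; last exact: normoneM.
have -> : #|[set u in normone | delta u == b]| = (\sum_(y <- D2 L) (y == b))%N.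
  rewrite cE -sum1dep_card big_mkcondr /=; apply: eq_bigr => w _.
  by case: eqP.
by rewrite card_normone => e; nia.
Qed.

(** With k = [beta^-1], scaling both arguments on the right by s c / k gives
    [kap (s *: x) (c *: y)], to which [kap_swap] applies. *)
Lemma kap_inv (c s : F) x y : c != 0 -> s != 0 -> x \in normone -> y \in normone ->
  kap (c *: x) (s *: y)
    = kap (((beta F)^-1 * c^-1) *: x) (((beta F)^-1 * s^-1) *: y).
Proof.
move=> cN0 sN0 x1 y1.
have betaN0 : (beta F)^-1 != 0 by rewrite invr_eq0 oppr_eq0 invr_eq0 three_neq0.
move: (beta F)^-1 betaN0 => k kN0.
have skN0 : s * c / k != 0 by apply: mulf_neq0; rewrite ?invr_neq0 ?mulf_neq0.
rewrite kap_swap // -[RHS](kapZ _ _ skN0) !scalerA.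
have -> : s * c / k * (k * c^-1) = s by rewrite mulrA divfK // mulfK.
by have -> : s * c / k * (k * s^-1) = c by rewrite mulrA divfK // [s * c]mulrC mulfK.
Qed.

Lemma sum_kap_D1 b : b \in T0 L ->
  (\sum_(z <- D1 L) kap z b
    = q ^ 3 + 2 * q ^ 2 + q + q ^ 2 * count_mem b (D1 L))%N.
Proof.
rewrite T0E => /andP[/normone_scale[s [y y1 [sN0 bE]]] _].
pose b' : K := ((beta F)^-1 * s^-1) *: y.
have betaN0 : (beta F)^-1 != 0 by rewrite invr_eq0 oppr_eq0 invr_eq0 three_neq0.
have b'N0 : b' != 0.
  by rewrite scaler_eq0 mulf_eq0 negb_or negb_or betaN0 invr_eq0 sN0 normone_neq0.
(* The involution matches the entries of [D1] and [D2] index by index and sends [b] to [b']. It is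
   used twice: for [kap], and for the multiplicity of [b]. *)
have sumD (f g : K -> nat) :
    (forall x (c : F), c != 0 -> x \in normone ->
       f (c *: x) = g (((beta F)^-1 * c^-1) *: x)) ->
    (\sum_(z <- D1 L) f z = \sum_(z <- D2 L) g z)%N.
  move=> fg; rewrite /D1 /D2 !big_allpairs_dep /= !big_enum /=.
  apply: eq_bigr => x xL0; rewrite !big_enum /=; apply: eq_bigr => a _.
  rewrite fg //; first exact: cD_neq0.
  by move: xL0; rewrite L0E => /andP[].
rewrite bE count_sum.
rewrite (sumD _ (fun z => kap z b')); last by move=> x c cN0 x1; apply: kap_inv.
rewrite (sumD _ (fun z => z == b')) ?sum_kap_D2 ?count_sum // => x c cN0 x1.
congr nat_of_bool; apply/eqP/eqP => [e|e].
  have cs := normone_scale_inj x1 y1 e.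
  by move: e; rewrite /b' cs => /(scalerI sN0) ->.
have /(mulfI betaN0)/invr_inj cs := normone_scale_inj x1 y1 e.
have ksN0 : (beta F)^-1 * s^-1 != 0 by rewrite mulf_neq0 // invr_neq0.
by move: e; rewrite /b' cs => /(scalerI ksN0) ->.
Qed.

(** * Size of [E] and the sum of [kap] over it *)

Section IsE.
Variable E : {set K}.
Hypothesis isE : is_E E.

Lemma D1D2_cone z : z \in D1 L ++ D2 L ->
  exists c : F, exists2 x, x \in L0 L & c != 0 /\ z = c *: x.
Proof.
have betaN0 : (beta F)^-1 != 0 by rewrite invr_eq0 oppr_eq0 invr_eq0 three_neq0.
rewrite mem_cat => /orP[] /allpairsP[[x a] /= [+ _ ->]]; rewrite mem_enum => xL0.
  by exists (cD x a), x => //; split=> //; apply: cD_neq0.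
exists ((beta F)^-1 * (cD x a)^-1), x => //; split=> //.
by rewrite mulf_neq0 // invr_neq0 // cD_neq0.
Qed.

Lemma D1D2_T0 z : z \in D1 L ++ D2 L -> z \in T0 L.
Proof.
move=> /D1D2_cone[c [x xL0 [cN0 ->]]]; move: xL0; rewrite L0E T0E => /andP[x1 /eqP x0].
by rewrite scaler_eq0 negb_or cN0 normone_neq0 // inE trZ x0 scaler0 eqxx.
Qed.

Lemma count_E z :
  (count_mem z (D1 L) + count_mem z (D2 L) = 3 * (z \in E) + (z \in T0 L))%N.
Proof.
have [E0 cE] := isE; have [->|] := eqVneq z 0; last exact: cE.
rewrite (negPf E0) T0E eqxx /= -count_cat; apply/eqP; rewrite -leqn0 leqNgt -has_count.
apply/hasPn=> x /D1D2_T0; rewrite T0E => /andP[xN0 _] /=.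
exact: xN0.
Qed.

Lemma E_sub_T0 z : z \in E -> z \in T0 L.
Proof.
move=> zE; apply: D1D2_T0; rewrite -has_pred1 has_count count_cat count_E zE.
by case: (z \in T0 L).
Qed.

Lemma sum_E (f : K -> nat) :
  (\sum_(z <- D1 L) f z + \sum_(z <- D2 L) f z
    = 3 * \sum_(z in E) f z + \sum_(z in T0 L) f z)%N.
Proof.
have sum_count (s : seq K) : (\sum_(z <- s) f z = \sum_z count_mem z s * f z)%N.
  elim: s => [|y s IHs]; first by rewrite big_nil big1.
  rewrite big_cons IHs (bigD1 y) //= [in RHS](bigD1 y) //= eqxx mulnDl mul1n addnA.
  by congr (_ + _)%N; apply: eq_bigr => z /negPf zy; rewrite eq_sym zy.
rewrite !sum_count -big_split /=.
under eq_bigr do rewrite -mulnDl count_E mulnDl -mulnA.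
rewrite big_split /= -big_distrr /=; congr (3 * _ + _)%N.
  by rewrite [RHS]big_mkcond; apply: eq_bigr => z _; case: (z \in E); rewrite ?mul1n.
by rewrite [RHS]big_mkcond; apply: eq_bigr => z _; case: (z \in T0 L); rewrite ?mul1n.
Qed.

Lemma sum_tr0_set (f : K -> nat) :
  (\sum_(z in tr0_set) f z = f 0%R + \sum_(z in T0 L) f z)%N.
Proof.
rewrite (big_setD1 0) /=; last by rewrite inE tr0.
by congr (_ + _)%N; apply: eq_bigl => z; rewrite T0E in_setD1.
Qed.

(** [D1] and [D2] have q^2 + q entries each and [T0] has q^2 - 1, so 3 |E| = 2 (q^2 + q) - (q^2 -
    1). *)
Lemma card_E : (3 * #|E| = q.+1 ^ 2)%N.
Proof.
have := sum_E (fun=> 1%N); have := sum_D2 (fun=> 1%N); have := sum_tr0_set (fun=> 1%N).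
rewrite !sum1_card card_normone card_tr0 !sum1_size.
have -> : size (D1 L) = size (D2 L) by rewrite !size_allpairs.
by nia.
Qed.

Lemma sum_kap_E b : b \in T0 L ->
  (\sum_(z in E) kap z b = #|E| * q.+1 + q ^ 2 * (b \in E))%N.
Proof.
move=> bT; have := bT; rewrite T0E => /andP[bN0 b0].
have := sum_E (fun z => kap z b); have := sum_tr0_set (fun z => kap z b).
rewrite sum_kap_tr0 // kap0 // sum_kap_D1 // sum_kap_D2 //.
have := count_E b; rewrite bT; have := card_E.
set c1 := count_mem _ _; set c2 := count_mem _ _; set e := nat_of_bool (b \in E).
set S := (\sum_(z in E) _)%N; set S0 := (\sum_(z in T0 L) _)%N.
move=> cE c12 e1 e2.
(* Here 3 S = 2 (q^3 + 2 q^2 + q) + q^2 (3 e + 1) - (q^3 + 2 q^2 - q - 1) = (q + 1)^3 + 3 q^2 e, and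
   (q + 1)^2 = 3 |E|. *)
have : (3 * S = 3 * (#|E| * q.+1 + q ^ 2 * e))%N by nia.
by lia.
Qed.

End IsE.

(** * The line set *)

Section LineSet.
Variables (E : {set K}) (C0 : {group {unit K}}) (phi : 'Hom('rV[F]_6, (K * K)%type)).
Hypotheses (isE : is_E E) (cardC0 : #|C0| = (q ^ 2 + q + 1)%N).
Hypothesis kphi : klein_identification phi.
Local Notation A := (lines_of phi (setM C0 E)).

(** Elements of [C0] satisfy mu^(q^2 + q + 1) = 1, which says norm 1, and both sets have the same
    size. *)
Lemma imset_val_C0 : [set val mu | mu in C0] = normone.
Proof.
apply/eqP; rewrite eqEcard card_imset; last exact: val_inj.
rewrite cardC0 card_normone leqnn andbT; apply/subsetP=> _ /imsetP[mu mu0 ->].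
have := expg_cardG mu0; rewrite cardC0 => /(congr1 val); rewrite FinRing.val_unitX /= => mu1.
rewrite inE /nm frob_frob /frob -[X in X * _ * _]expr1 -!exprD.
by rewrite addnC addnA addnAC -mu1 eqxx.
Qed.

Definition qvec (p : K * K) : K * K := (p.1, p.1^-1 * p.2).

Lemma mem_setM (P : {vspace (K * K)%type}) :
  reflect (exists p : K * K, p \in setX normone E /\ P = <[qvec p]>%VS)
    (P \in setM C0 E).
Proof.
apply: (iffP bigcupP) => [[z zE /imsetP[mu muC0 ->]]|[[m z] [/setXP[/= m1 zE] ->]]].
  exists (val mu, z); rewrite in_setX zE andbT -imset_val_C0 imset_f //.
  by rewrite /= mulr1.
exists z => //; move: m1; rewrite -imset_val_C0 => /imsetP[mu muC0 ->].
by apply/imsetP; exists mu; rewrite // mulr1.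
Qed.

(** First components of norm 1 are proportional over [F] only with factor 1. *)
Lemma point_inj : {in setX normone E &,
  injective (fun p : K * K => <[qvec p]>%VS)}.
Proof.
move=> [m z] [m' z'] /setXP[/= m1 _] /setXP[/= m1' _] /= eq_pt.
have : qvec (m, z) \in <[qvec (m', z')]>%VS.
  by rewrite -eq_pt memv_line.
case/vlineP=> k kE; have mE : m = k *: m' := congr1 fst kE.
have zE : m^-1 * z = k *: (m'^-1 * z') := congr1 snd kE.
have k1 : 1 = k by apply: (normone_scale_inj m1 m1'); rewrite scale1r.
rewrite -k1 scale1r in mE; rewrite -k1 scale1r mE in zE.
by rewrite mE (mulfI _ zE) // invr_eq0 normone_neq0.
Qed.

Lemma phi_inj : injective phi.
Proof. by case: kphi => /bij_inj. Qed.

Lemma limg_vline_inj (w w' : 'rV[F]_6) :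
  (phi @: <[w]> = phi @: <[w']> -> <[w]> = <[w']>)%VS.
Proof.
rewrite !limg_line => e; apply/eqP; rewrite eqEsubv -!memvE.
have /vlineP[k /=] : phi w \in <[phi w']>%VS by rewrite -e memv_line.
have /vlineP[k' /=] : phi w' \in <[phi w]>%VS by rewrite e memv_line.
rewrite -!linearZ => /phi_inj e1 /phi_inj e2.
by apply/andP; split; [rewrite e2 | rewrite e1]; rewrite memvZ // memv_line.
Qed.

Lemma Q_tr (v : K * K) : (Q v)%:A = tr (v.1 * v.2).
Proof. by rewrite /Q trKE. Qed.

Lemma klein_pol_phi (w w' : 'rV[F]_6) :
  (klein_pol w w' == 0) =
  (tr ((phi w).1 * (phi w').2 + (phi w').1 * (phi w).2) == 0).
Proof.
have [_ [c cN0 Qphi]] := kphi.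
have <- : (c * klein_pol w w')%:A
    = tr ((phi w).1 * (phi w').2 + (phi w').1 * (phi w).2).
  rewrite /klein_pol !mulrBr -!Qphi !scalerBl !Q_tr linearD /=.
  by rewrite mulrDl !mulrDr !trD; ring.
by rewrite scaler_eq0 oner_eq0 orbF mulf_eq0 (negPf cN0).
Qed.

Lemma singular_phi (w : 'rV[F]_6) :
  (klein_form w == 0) = (tr ((phi w).1 * (phi w).2) == 0).
Proof.
have [_ [c cN0 Qphi]] := kphi.
by rewrite -Q_tr Qphi scaler_eq0 oner_eq0 orbF mulf_eq0 (negPf cN0).
Qed.

(** Lines and pairs (m, z) are both mapped injectively to points of the quadric, by [g] and [h],
    with the same image. *)
Lemma card_lines_of (Pm : pred {vspace 'rV[F]_4}) (Pz : pred (K * K)) :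
    (forall l (w : 'rV[F]_6) m z, \dim l = 2%N -> klein_point l = <[w]>%VS ->
       m \in normone -> z \in E -> phi w = qvec (m, z) -> Pm l = Pz (m, z)) ->
  #|[set l in A | Pm l]| = #|[set p in setX normone E | Pz p]|.
Proof.
move=> PmPz; have [[psi _ phiK] _] := kphi.
pose g (l : {vspace 'rV[F]_4}) := (phi @: klein_point l)%VS.
pose h (p : K * K) : {vspace (K * K)%type} := <[qvec p]>%VS.
have g_inj : {in [set l in A | Pm l] &, injective g}.
  move=> l l'; rewrite !inE => /andP[/andP[/eqP dl _] _] /andP[/andP[/eqP dl' _] _].
  have [w lw _] := klein_point_singular dl; have [w' lw' _] := klein_point_singular dl'.
  rewrite /g lw lw' => /limg_vline_inj ww'; apply: klein_point_inj => //.
  by rewrite lw lw'.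
have h_inj : {in [set p in setX normone E | Pz p] &, injective h}.
  by move=> p p' /setIdP[? _] /setIdP[? _]; apply: point_inj.
rewrite -(card_in_imset g_inj) -(card_in_imset h_inj); apply: eq_card => P.
have gh l m z : \dim l = 2%N -> m \in normone -> z \in E -> g l = h (m, z) -> Pm l = Pz (m, z).
  move=> dl m1 zE gl; apply: (PmPz l (psi (qvec (m, z)))) => //.
  have [w lw _] := klein_point_singular dl; rewrite lw.
  by apply: limg_vline_inj; rewrite -lw [RHS]limg_line phiK.
apply/imsetP/imsetP => [[l + ->]|[[m z] + ->]].
  case/setIdP; rewrite inE => /andP[]; rewrite inE => /eqP dl /mem_setM[[m z] [mz gl]] Pl.
  have [/= m1 zE] := setXP mz.
  by exists (m, z); rewrite // inE mz -(gh l).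
case/setIdP=> mz Pmz; have [/= m1 zE] := setXP mz.
have mN0 := normone_neq0 m1.
have [||l dl lw] := @klein_point_surj F (psi (qvec (m, z))).
- apply: contraNneq mN0 => psi0; have := phiK (qvec (m, z)).
  by rewrite psi0 linear0 => -[<-].
(* The vector is singular because m (m^-1 z) = z has trace 0. *)
- apply/eqP; rewrite singular_phi phiK /= mulVKf //.
  by have := E_sub_T0 isE zE; rewrite T0E inE => /andP[].
have gl : g l = h (m, z) by rewrite /g lw limg_line phiK.
exists l; rewrite // inE (gh l m z) // Pmz andbT !inE dl eqxx /=.
by apply/mem_setM; exists (m, z).
Qed.

Lemma card_lines : #|A| = (#|E| * (q ^ 2 + q + 1))%N.
Proof.
have := @card_lines_of xpredT xpredT (fun _ _ _ _ _ _ _ _ _ => erefl).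
have -> : [set l in A | true] = A by apply/setP=> l; rewrite inE andbT.
have -> : [set p in setX normone E | true] = setX normone E.
  by apply/setP=> l; rewrite inE andbT.
by move=> ->; rewrite cardsX card_normone mulnC.
Qed.

Lemma kap_r0 z : z != 0 -> kap z 0 = q.+1.
Proof.
move=> zN0; rewrite -(card_orth zN0) kap_sum -sum1dep_card big_mkcondr /=.
rewrite (reindex_inj invr_inj) /=; apply: eq_big => m.
  by apply/idP/idP => /normoneV; rewrite ?invrK.
by move=> _; rewrite mulr0 addr0 invrK; case: eqP.
Qed.

Lemma card_meet l : l \in pg_lines F ->
  #|[set m in A | (m :&: l)%VS != 0%VS]| = (#|E| * q.+1 + q ^ 2 * (l \in A))%N.
Proof.
rewrite inE => /eqP dl; have [w0 lw0 [w0N0 w0s]] := klein_point_singular dl.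
have lA : (l \in A) = (<[phi w0]>%VS \in setM C0 E).
  by rewrite inE inE dl eqxx /= lw0 limg_line.
have vN0 : phi w0 != 0.
  by apply: contraNneq w0N0 => e; apply/eqP/phi_inj; rewrite e linear0.
have /eqP := w0s; rewrite singular_phi => /eqP ab0.
pose Pz (p : K * K) := tr (p.1 * (phi w0).2 + (phi w0).1 * (p.1^-1 * p.2)) == 0.
rewrite (@card_lines_of (fun m : {vspace 'rV[F]_4} => (m :&: l)%VS != 0%VS) Pz); last first.
  move=> m w x z dm mw _ _ phiw.
  by rewrite -(line_meetP dm dl mw lw0) klein_pol_phi phiw.
rewrite lA {lA} /Pz.
rewrite card_setX_fiber /=.
case: (phi w0) vN0 ab0 => a b /= vN0 ab0.
(* For a = 0 the condition is tr(m b) = 0, with q + 1 solutions for every z, and the point is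
   outside the set since its first component is 0. *)
have [a0|aN0] := eqVneq a 0.
  have bN0 : b != 0 by apply: contraNneq vN0 => b0; rewrite a0 b0.
  have /negPf-> : <[(a, b) : K * K]>%VS \notin setM C0 E.
    apply/mem_setM=> -[[m z] [/setXP[/= /normone_neq0 mN0 _] e]].
    have /vlineP[k kE] : qvec (m, z) \in <[(a, b) : K * K]>%VS by rewrite e memv_line.
    have mE : m = k *: a := congr1 fst kE.
    by rewrite mE a0 scaler0 eqxx in mN0.
  rewrite muln0 addn0 -sum_nat_const; apply: eq_bigr => z _.
  by rewrite -(card_orth bN0); apply: eq_card => m; rewrite !inE a0 mul0r addr0.
(* Writing a = s v with v of norm 1 gives (a, b) = s (v, v^-1 b'), a point in the orbit of <(1,
   b')>. *)
have [s [v v1 [sN0 aE]]] := normone_scale aN0.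
have vN0' := normone_neq0 v1.
pose b' := v * (s^-1 *: b).
have bE : b = s *: (v^-1 * b') by rewrite /b' mulKf // scalerA divff // scale1r.
have b'0 : tr b' = 0.
  apply/eqP; rewrite -(inj_eq (scalerI sN0)) -(inj_eq (scalerI sN0)) !scaler0.
  rewrite -!trZ /b' -scalerAr !scalerA mulfK // scalerAl -aE ab0 //.
have -> : (<[(a, b) : K * K]>%VS \in setM C0 E) = (b' \in E).
  have eq_pt : <[(a, b) : K * K]>%VS = <[qvec (v, b')]>%VS.
    have -> : (a, b) = s *: qvec (v, b') by rewrite aE {1}bE.
    by rewrite vline_scale.
  apply/mem_setM/idP => [[[m z] [mz e]]|b'E]; last first.
    by exists (v, b'); rewrite in_setX v1.
  have /vlineP[k kE] : qvec (v, b') \in <[qvec (m, z)]>%VS.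
    by rewrite -e eq_pt memv_line.
  have [/= m1 zE] := setXP mz; have vE : v = k *: m := congr1 fst kE.
  have k1 : 1 = k by apply: (normone_scale_inj v1 m1); rewrite scale1r.
  have b'E : v^-1 * b' = k *: (m^-1 * z) := congr1 snd kE.
  rewrite -k1 scale1r in vE; rewrite -k1 scale1r -vE in b'E.
  by rewrite (mulfI _ b'E) // invr_neq0.
(* Replacing m by m v removes v from the equation and leaves the factor s. *)
transitivity (\sum_(z in E) kap z b')%N.
  apply: eq_bigr => z _; rewrite kap_sum -sum1dep_card big_mkcondr /=.
  rewrite (reindex_inj (mulIf vN0')) /=; apply: eq_big => m.
    by apply/idP/idP => [/normoneM/(_ (normoneV v1))|/normoneM/(_ v1)]; rewrite ?mulfK.
  move=> _.
  have -> : m * v * b + a * ((m * v)^-1 * z) = s *: (m^-1 * z + m * b').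
    rewrite bE aE -scalerAr -scalerAl -scalerDr addrC; congr (_ *: (_ + _)).
      by rewrite invfM mulrA mulrCA divff // mulr1.
    by rewrite mulrA mulfK.
  by rewrite trZ scaler_eq0 (negPf sN0) /=; case: eqP.
(* The value b' = 0 lies outside [T0] and is treated directly: every z in [E] contributes q + 1, and
   0 is not in [E]. *)
have [->|b'N0] := eqVneq b' 0.
  have [E0 _] := isE; rewrite (negPf E0) muln0 addn0 -sum_nat_const.
  by apply: eq_bigr => z zE; rewrite kap_r0 //; apply: contraNneq E0 => <-.
by rewrite sum_kap_E // T0E b'N0 inE b'0 eqxx.
Qed.

End LineSet.

End CubicField.

Theorem theorem3p5 (F : finFieldType) (L : fieldExtType F)
    (E : {set finvect_type L}) (C0 : {group {unit finvect_type L}})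
    (phi : 'Hom('rV[F]_6, (finvect_type L * finvect_type L)%type)) :
  (#|F| = 2 %[mod 3])%N ->
  \dim {: L} = 3%N ->
  is_E E ->
  #|C0| = (#|F| ^ 2 + #|F| + 1)%N ->
  klein_identification phi ->
  cameron_liebler (lines_of phi (setM C0 E)) ((#|F| + 1) ^ 2 %/ 3)%N.
Proof.
move=> q_mod3 dimL isE cardC0 kphi.
have cE := card_E dimL q_mod3 isE.
have -> : ((#|F| + 1) ^ 2 %/ 3 = #|E|)%N by rewrite addn1 -cE mulKn.
apply: cameron_liebler_criterion => [|||l].
- by apply/subsetP=> l; rewrite inE => /andP[].
- by move: cE; case: #|E|; rewrite // muln0.
- exact: card_lines.
exact: card_meet.
Qed.
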